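(* Let $\theta\in\mathbb{R}$ be such that $\theta/2\pi$ is irrational and let $\alpha\in\mathbb{R}$. Let $f:\mathbb{T}\to\mathbb{T}$ be continuous and such that the $C^*$-dynamical system $(\mathbb{A}_\alpha,\Phi_{\theta,f},\tau)$ is ergodic. Then $(\mathbb{A}_\alpha,\Phi_{\theta,f})$ is uniquely ergodic, with the canonical trace $\tau$ as the unique invariant state.
   Context: $\mathbb{T}=\{z\in\mathbb{C}: |z|=1\}$. For $\alpha\in\mathbb{R}$, the noncommutative 2-torus $\mathbb{A}_\alpha$ is the universal unital $C^*$-algebra generated by two unitaries $U,V$ satisfying $UV=e^{2\pi\imath\alpha}VU$. Its canonical faithful tracial state $\tau$ is determined by $\tau(U^mV^n)=\delta_{m,0}\delta_{n,0}$, $m,n\in\mathbb{Z}$. For $\theta\in\mathbb{R}$ and a continuous $f:\mathbb{T}\to\mathbb{T}$, the Anzai skew-product $\Phi_{\theta,f}$ is the $*$-automorphism of $\mathbb{A}_\alpha$ uniquely determined by $\Phi_{\theta,f}(U)=e^{\imath\theta}U$ and $\Phi_{\theta,f}(V)=f(U)V$, where $f(U)$ is given by continuous functional calculus; it leaves $\tau$ invariant. The system $(\mathbb{A}_\alpha,\Phi_{\theta,f},\tau)$ is called ergodic if $\tau$ is an extreme point of the convex set of $\Phi_{\theta,f}$-invariant states of $\mathbb{A}_\alpha$. The system $(\mathbb{A}_\alpha,\Phi_{\theta,f})$ is uniquely ergodic if there is exactly one state $\varphi$ of $\mathbb{A}_\alpha$ with $\varphi\circ\Phi_{\theta,f}=\varphi$.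 *)

(* Defs.v *)
From HB Require Import structures.
From mathcomp Require Import all_boot all_order all_algebra.
From mathcomp Require Import complex.
From mathcomp Require Import all_classical all_reals all_analysis.

Set Implicit Arguments.
Unset Strict Implicit.
Unset Printing Implicit Defensive.
Import Order.TTheory GRing.Theory Num.Theory.
Import numFieldNormedType.Exports.

Local Open Scope classical_set_scope.
Local Open Scope ring_scope.
Local Open Scope complex_scope.

(* Unital C*-algebras over R[i].  The norm is a separate operation cnorm: the
   hierarchy has no join of rings and normed modules below numDomainType, so an
   algType cannot also carry the library's normed module structure. *)
HB.mixin Record isCstarAlgebra (R : realType) A & GRing.Algebra R[i] A := {
  cnorm : A -> R;
  star : A -> A;
  cnorm_eq0 : forall a : A, cnorm a = 0 -> a = 0;
  cnormD : forall a b : A, cnorm (a + b) <= cnorm a + cnorm b;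
  cnormZ : forall (c : R[i]) (a : A), cnorm (c *: a) = complex.Re `|c| * cnorm a;
  cnormM : forall a b : A, cnorm (a * b) <= cnorm a * cnorm b;
  cnorm_complete : forall x : nat -> A,
    (forall e : R, 0 < e -> exists N, forall m n, (N <= m)%N -> (N <= n)%N ->
       cnorm (x m - x n) < e) ->
    exists l : A, (fun n => cnorm (x n - l)) @ \oo --> (0 : R);
  starK : involutive star;
  starD : {morph star : a b / a + b};
  starZ : forall (c : R[i]) (a : A), star (c *: a) = Num.conj c *: star a;
  starM : forall a b : A, star (a * b) = star b * star a;
  cnorm_star : forall a : A, cnorm (star a * a) = cnorm a ^+ 2
}.

#[short(type="cstarAlgType")]
HB.structure Definition CstarAlgebra (R : realType) :=
  {A of isCstarAlgebra R A & GRing.Algebra R[i] A}.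

Definition cis (R : realType) (t : R) : R[i] := cos t +i* sin t.

Definition circle (R : realType) : set R[i] := [set z | `|z| = 1].
Arguments circle : clear implicits.

Section CstarDefs.
Variable R : realType.
Implicit Types A B : cstarAlgType R.

Definition unitary A (u : A) : Prop := star u * u = 1 /\ u * star u = 1.

Definition cstar_closed A (S : set A) : Prop :=
  forall (x : nat -> A) (l : A), (forall n, S (x n)) ->
    (fun n => cnorm (x n - l)) @ \oo --> (0 : R) -> S l.

Definition cstar_subalgebra A (S : set A) : Prop :=
  [/\ cstar_closed S, S 1, (forall (c : R[i]) a b, S a -> S b -> S (c *: a + b)),
      (forall a b, S a -> S b -> S (a * b)) & (forall a, S a -> S (star a))].

Definition star_preserving A B (h : A -> B) : Prop :=
  forall a, h (star a) = star (h a).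

Definition rotation_pair A (alpha : R) (u v : A) : Prop :=
  [/\ unitary u, unitary v & u * v = cis (2 * pi * alpha) *: (v * u)].

(* (A, U, V) is the noncommutative 2-torus: the universal unital C*-algebra
   generated by a pair of unitaries satisfying the commutation relation.  The
   morphism h is unique because U and V generate A. *)
Record is_nctorus (alpha : R) A (U V : A) : Prop := {
  nctorus_rel : rotation_pair alpha U V;
  nctorus_gen : forall S : set A, cstar_subalgebra S -> S U -> S V -> S = setT;
  nctorus_univ : forall B (u v : B), rotation_pair alpha u v ->
    exists h : {lrmorphism A -> B}, [/\ star_preserving h, h U = u & h V = v]
}.

Definition is_state A (phi : A -> R[i]) : Prop :=
  [/\ scalar phi, (forall a, 0 <= phi (star a * a)) & phi 1 = 1].

(* Integer powers; the inverse of a unitary is its adjoint. *)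
Definition upow A (u : A) (m : int) : A :=
  match m with Posz n => u ^+ n | Negz n => star u ^+ n.+1 end.

Record is_canonical_trace A (U V : A) (tau : A -> R[i]) : Prop := {
  trace_state : is_state tau;
  trace_tracial : forall a b, tau (a * b) = tau (b * a);
  trace_faithful : forall a, tau (star a * a) = 0 -> a = 0;
  trace_monomial : forall m n : int,
    tau (upow U m * upow V n) = ((m == 0) && (n == 0))%:R
}.

(* C(T) is represented by functions on R[i] whose restriction to the circle is
   continuous, two of them being identified when they agree on the circle.  The
   topology of the modulus is the one attached to R[i]^o. *)
Definition circle_continuous (g : R[i] -> R[i]) : Prop :=
  {within (circle R : set R[i]^o), continuous (g : R[i]^o -> R[i]^o)}.

(* rho is a unital *-homomorphism C(T) -> A mapping the coordinate function
   to u, so that rho g is g(u). *)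
Record is_calculus A (u : A) (rho : (R[i] -> R[i]) -> A) : Prop := {
  calculus_ext : forall g h, circle_continuous g -> circle_continuous h ->
    {in circle R, g =1 h} -> rho g = rho h;
  calculus_linear : forall c g h, circle_continuous g -> circle_continuous h ->
    rho (fun z => c * g z + h z) = c *: rho g + rho h;
  calculus_mul : forall g h, circle_continuous g -> circle_continuous h ->
    rho (fun z => g z * h z) = rho g * rho h;
  calculus_star : forall g, circle_continuous g ->
    rho (fun z => Num.conj (g z)) = star (rho g);
  calculus_one : rho (fun=> 1) = 1;
  calculus_id : rho id = u
}.

Definition functional_calculus A (u : A) (g : R[i] -> R[i]) (a : A) : Prop :=
  exists2 rho, is_calculus u rho & rho g = a.

Record is_anzai A (U V : A) (theta : R) (f : R[i] -> R[i])
    (Phi : {lrmorphism A -> A}) : Prop := {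
  anzai_star : star_preserving Phi;
  anzai_bij : bijective Phi;
  anzai_U : Phi U = cis theta *: U;
  anzai_V : exists2 fU, functional_calculus U f fU & Phi V = fU * V
}.

Definition invariant_states A (Phi : A -> A) : set (A -> R[i]) :=
  [set phi | is_state phi /\ phi \o Phi = phi].

Definition extreme_point A (K : set (A -> R[i])) (x : A -> R[i]) : Prop :=
  K x /\ forall (y z : A -> R[i]) (t : R), K y -> K z -> 0 < t < 1 ->
    x = (fun a => t%:C * y a + (1 - t)%:C * z a) -> y = x /\ z = x.

Definition is_ergodic A (Phi : A -> A) (tau : A -> R[i]) : Prop :=
  extreme_point (invariant_states Phi) tau.

Definition uniquely_ergodic A (Phi : A -> A) : Prop :=
  exists! phi, invariant_states Phi phi.

End CstarDefs.

(* Main.v *)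
(* Idea.  Let phi be an invariant state.  The gauge automorphisms h_z : U |-> U,
   V |-> z V (z in the circle) commute with Phi, because h_z fixes f(U), so
   every phi o h_z is invariant.  Averaging phi o h_z against the densities
   1 + cos(k t) and 1 - cos(k t), k <> 0, yields two invariant states; their
   midpoint kills U^m V^n for n <> 0 and agrees with phi on the powers of U,
   where irrationality of theta / (2 pi) forces phi(U^m) = 0 for m <> 0.  The
   midpoint is thus tau, and extremality makes both averages equal to tau.
   Since the first one takes the value phi(U^m V^k) / 2 at U^m V^k, phi
   vanishes there, and phi = tau by density of the monomials.

   That h_z fixes f(U) is uniqueness of the functional calculus: f is a uniform
   limit of trigonometric polynomials, and for a function g bounded by e on the
   circle, tau(g(U)^* g(U)) <= e^2; faithfulness of tau concludes without any
   norm estimate on *-homomorphisms. *)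
Require Import Defs.
From mathcomp Require Import all_boot all_order all_algebra.
From mathcomp Require Import complex ring lra zify.
From mathcomp Require Import all_classical all_reals all_analysis.
Import Order.TTheory GRing.Theory Num.Theory.
Import numFieldNormedType.Exports.
Set Implicit Arguments.
Unset Strict Implicit.
Unset Printing Implicit Defensive.
Local Open Scope classical_set_scope.
Local Open Scope ring_scope.
Local Open Scope complex_scope.

(** * C*-algebras and positive functionals *)

Lemma le0_small (R : realType) (x C : R) :
  (forall e : R, 0 < e -> x <= C * e) -> x <= 0.
Proof.
move=> xC; have C1 : 0 < `|C| + 1 by rewrite ltr_pwDr.
apply/ler_addgt0Pr => e e0; rewrite add0r.
have := xC (e / (`|C| + 1)) (divr_gt0 e0 C1); move/le_trans; apply.
rewrite mulrCA -[leRHS]mulr1 ler_pM2l// ler_pdivrMr// mul1r.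
by rewrite (le_trans (ler_norm _))// lerDl.
Qed.

Section CstarBasics.
Context {R : realType} {A : cstarAlgType R}.
Implicit Types (a b c : A) (phi : A -> R[i]).

Lemma cnorm0 : cnorm (0 : A) = 0.
Proof. by rewrite -(scale0r (0 : A)) cnormZ normr0 mul0r. Qed.

Lemma cnormN a : cnorm (- a) = cnorm a.
Proof. by rewrite -scaleN1r cnormZ normrN1 mul1r. Qed.

(** Nonnegativity is not an axiom of [isCstarAlgebra]; it follows from 0 = ||a - a|| <= 2 ||a||. *)
Lemma cnorm_ge0 a : 0 <= cnorm a.
Proof.
have := cnormD a (- a); rewrite subrr cnorm0 cnormN; lra.
Qed.

Lemma cnormB a b : cnorm (a - b) <= cnorm a + cnorm b.
Proof. by rewrite -(cnormN b); exact: cnormD. Qed.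

Lemma cnorm_half a : cnorm ((2^-1 : R[i]) *: a) = 2^-1 * cnorm a.
Proof.
rewrite cnormZ -[X in `|X|]/((2 : R[i])^-1).
have -> : (2^-1 : R[i]) = (2^-1)%:C by rewrite rmorphV ?rmorph_nat ?unitfE ?pnatr_eq0.
by rewrite ger0_norm ?ler0c ?invr_ge0 ?ler0n.
Qed.

(** The C*-identity and submultiplicativity give ||a||^2 <= ||star a|| ||a||; divide by ||a|| when
    it is positive. *)
Lemma cnorm_star_le a : cnorm a <= cnorm (star a).
Proof.
have := cnormM (star a) a; rewrite cnorm_star expr2.
have := cnorm_ge0 a; rewrite le0r => /orP[/eqP-> _|a0]; first exact: cnorm_ge0.
by rewrite ler_pM2r.
Qed.

Lemma cnorm_starE a : cnorm (star a) = cnorm a.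
Proof.
apply/eqP; rewrite eq_le cnorm_star_le andbT.
by rewrite -{2}(starK a) cnorm_star_le.
Qed.

Lemma star0 : star (0 : A) = 0.
Proof. by apply: (addrI (star 0)); rewrite -starD !addr0. Qed.

Lemma star1 : star (1 : A) = 1.
Proof. by rewrite -[LHS]mul1r -{1}(starK 1) -starM mul1r starK. Qed.

Lemma starN a : star (- a) = - star a.
Proof. by rewrite -scaleN1r starZ rmorphN1 scaleN1r. Qed.

Lemma starB a b : star (a - b) = star a - star b.
Proof. by rewrite starD starN. Qed.

Lemma cnorm_small_eq0 a (C : R) :
  (forall e : R, 0 < e -> cnorm a <= C * e) -> a = 0.
Proof.
move=> aC; apply: cnorm_eq0; apply/eqP; rewrite eq_le cnorm_ge0 andbT.
exact: le0_small aC.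
Qed.

Lemma cnorm_cvgP (x : nat -> A) (l : A) :
  (fun n => cnorm (x n - l)) @ \oo --> (0 : R) <->
  (forall e : R, 0 < e -> exists N, forall n, (N <= n)%N -> cnorm (x n - l) < e).
Proof.
split=> [/cvgrPdist_lt xl e e0|xl].
  have [N _ NP] := xl e e0; exists N => n Nn.
  by have := NP n Nn; rewrite sub0r normrN ger0_norm ?cnorm_ge0.
apply/cvgrPdist_lt => e e0; have [N NP] := xl e e0; exists N => // n Nn.
by rewrite sub0r normrN ger0_norm ?cnorm_ge0//; exact: NP.
Qed.

Lemma cnorm_subM (a b c d : A) :
  cnorm (a * b - c * d) <= cnorm a * cnorm (b - d) + cnorm (a - c) * cnorm d.
Proof.
have -> : a * b - c * d = a * (b - d) + (a - c) * d.
  by rewrite mulrBr mulrBl addrA subrK.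
by rewrite (le_trans (cnormD _ _))// lerD// cnormM.
Qed.

(* The square root of 1 - b is 1 - y with y the fixed point of
   y |-> (b + y^2) / 2, a contraction of the ball of radius 1/2. *)
Lemma cstar_sqrt b : star b = b -> cnorm b <= 4^-1 ->
  exists c, star c * c = 1 - b.
Proof.
move=> sb b4.
pose T y : A := (2^-1 : R[i]) *: (b + y * y).
pose y n := iter n T 0.
have yS n : y n.+1 = T (y n) by [].
(* The ball of radius 1/2 is stable under [T], since (1/4 + 1/4) / 2 <= 1/2. *)
have ynorm n : cnorm (y n) <= 2^-1.
  elim: n => [|n IH]; first by rewrite cnorm0; lra.
  rewrite yS cnorm_half.
  have h := cnormD b (y n * y n); have h2 := cnormM (y n) (y n).
  have : cnorm (y n) * cnorm (y n) <= 2^-1 * 2^-1 by rewrite ler_pM ?cnorm_ge0.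
  lra.
have TB u v : cnorm (T u - T v) <= 2^-1 * (cnorm u + cnorm v) * cnorm (u - v).
  rewrite /T -scalerBr cnorm_half opprD addrACA subrr add0r -mulrA ler_pM2l; last lra.
  by rewrite (le_trans (cnorm_subM u u v v))// mulrDl (mulrC (cnorm v)).
have ystar n : star (y n) = y n.
  elim: n => [|n IH]; first by rewrite star0.
  rewrite yS /T starZ starD starM sb IH; congr (_ *: _).
  by rewrite rmorphV ?unitfE ?pnatr_eq0// rmorph_nat.
(* On that ball the Lipschitz factor in [TB] is at most (1/2 + 1/2) / 2 = 1/2. *)
have ycauchy N k : cnorm (y (N + k)%N - y N) <= 2^-1 ^+ N.
  elim: N => [|N IH].
    by rewrite add0n expr0 subr0 (le_trans (ynorm k))//; lra.
  rewrite addSn !yS (le_trans (TB _ _))// exprS ler_pM ?cnorm_ge0//.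
    by rewrite mulr_ge0 ?addr_ge0 ?cnorm_ge0//; lra.
  by have := ynorm N; have := ynorm (N + k)%N; lra.
have pow_small (e : R) : 0 < e -> exists N, 2^-1 ^+ N < e :> R.
  move=> e0; have /cvgrPdist_lt/(_ _ e0) : (fun n => 2^-1 ^+ n : R) @ \oo --> (0 : R).
    by apply: cvg_expr; rewrite ger0_norm; lra.
  case=> N _ NP; exists N; have := NP N (leqnn N).
  by rewrite sub0r normrN ger0_norm// exprn_ge0//; lra.
have [l yl] : exists l, (fun n => cnorm (y n - l)) @ \oo --> (0 : R).
  apply: cnorm_complete => e e0.
  have [N Ne] := pow_small (e / 2) ltac:(lra).
  exists N => m n Nm Nn.
  rewrite -(subnKC Nm) -(subnKC Nn).
  have -> : y (N + (m - N))%N - y (N + (n - N))%N =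
     (y (N + (m - N))%N - y N) - (y (N + (n - N))%N - y N).
    by rewrite opprB addrA subrK.
  have := cnormB (y (N + (m - N))%N - y N) (y (N + (n - N))%N - y N).
  have := ycauchy N (m - N)%N; have := ycauchy N (n - N)%N; lra.
move/cnorm_cvgP: yl => yl.
have sl : star l = l.
  apply/eqP; rewrite -subr_eq0; apply/eqP.
  apply: (@cnorm_small_eq0 _ 2) => e e0; have [N /(_ N (leqnn N)) yN] := yl e e0.
  have -> : star l - l = (y N - l) - star (y N - l).
    by rewrite starB ystar opprB [RHS]addrC addrA addrNK.
  have := cnormB (y N - l) (star (y N - l)); rewrite cnorm_starE; lra.
have lT : l = T l.
  apply/eqP; rewrite -subr_eq0; apply/eqP.
  apply: (@cnorm_small_eq0 _ (1 + 2^-1 * (2^-1 + cnorm l))) => e e0.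
  have [N yN] := yl e e0.
  have y1 := yN _ (leqnn N); have y2 := yN _ (leqnSn N).
  have -> : l - T l = (y N.+1 - T l) - (y N.+1 - l) by rewrite opprB [RHS]addrC addrA addrNK.
  apply: (le_trans (cnormB _ _)).
  rewrite yS in y2 *; have := TB (y N) l.
  have : 2^-1 * (cnorm (y N) + cnorm l) * cnorm (y N - l) <=
         2^-1 * (2^-1 + cnorm l) * e.
    apply: ler_pM; rewrite ?cnorm_ge0 ?(ltW y1)//.
      by have := cnorm_ge0 (y N); have := cnorm_ge0 l; lra.
    by have := ynorm N; lra.
  lra.
(* The fixed point satisfies 2 l = b + l^2, hence (1 - l)^2 = 1 - b, and 1 - l is self-adjoint. *)
exists (1 - l); rewrite starB star1 sl.
have l2 : l + l = b + l * l.
  rewrite {1 2}lT /T -scalerDl.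
  have -> : (2^-1 + 2^-1 : R[i]) = 1.
    by field.
  by rewrite scale1r.
rewrite mulrBl mul1r mulrBr mulr1 opprB.
have -> : b = l + l - l * l by rewrite l2 addrK.
by rewrite !opprD !opprK !addrA addrAC.
Qed.

End CstarBasics.

Section Functionals.
Context {R : realType} {A : cstarAlgType R}.
Implicit Types (a b : A) (phi : A -> R[i]).

Section Linear.
Variable phi : A -> R[i].
Hypothesis phi_lin : scalar phi.

Lemma scalar0 : phi 0 = 0.
Proof. by have := phi_lin (-1) 0 0; rewrite scaler0 addr0 mulN1r addNr. Qed.

Lemma scalarD a b : phi (a + b) = phi a + phi b.
Proof. by have := phi_lin 1 a b; rewrite scale1r mul1r. Qed.

Lemma scalarZ c a : phi (c *: a) = c * phi a.
Proof. by have := phi_lin c a 0; rewrite scalar0 !addr0. Qed.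

Lemma scalarN a : phi (- a) = - phi a.
Proof. by rewrite -scaleN1r scalarZ mulN1r. Qed.

Lemma scalarB a b : phi (a - b) = phi a - phi b.
Proof. by rewrite scalarD scalarN. Qed.

End Linear.

Definition positive phi := scalar phi /\ forall a, 0 <= phi (star a * a).

Lemma state_positive phi : is_state phi -> positive phi.
Proof. by case. Qed.

Section Positive.
Variable phi : A -> R[i].
Hypothesis phi_pos : positive phi.
Let phi_lin : scalar phi := phi_pos.1.

Lemma positive1 : 0 <= phi 1.
Proof. by have := phi_pos.2 1; rewrite star1 mulr1. Qed.

(** By [cstar_sqrt], both 1 - b and 1 + b have the form [star c * c], so [phi] is nonnegative at
    each of them. *)
Lemma positive_small b : star b = b -> cnorm b <= 4^-1 -> `|phi b| <= phi 1.
Proof.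
move=> sb b4.
have h c : star c = c -> cnorm c <= 4^-1 -> 0 <= phi 1 - phi c.
  move=> sc /(cstar_sqrt sc)[d dE].
  by rewrite -(scalarB phi_lin) -dE; exact: phi_pos.2.
have h1 := h _ sb b4.
have h2 : 0 <= phi 1 + phi b.
  by have := h (- b); rewrite starN sb cnormN (scalarN phi_lin) opprK; exact.
(* [phi b] is the difference of the nonnegative numbers [phi 1] and [phi 1 - phi b]. *)
have br : phi b \is Num.real.
  by rewrite -(subKr (phi 1) (phi b)) rpredB// ger0_real// positive1.
rewrite real_ler_norml//; apply/andP; split; rewrite -subr_ge0//.
by rewrite opprK addrC.
Qed.

Lemma positive_bound_sa b : star b = b ->
  `|phi b| <= (4 * cnorm b)%:C * phi 1.
Proof.
move=> sb; have := cnorm_ge0 b; rewrite le0r => /orP[/eqP b0|b0].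
  by rewrite (cnorm_eq0 _ b0) (scalar0 phi_lin) normr0 cnorm0 mulr0 mul0r.
pose t : R := (4 * cnorm b)^-1.
have t0 : 0 < t by rewrite invr_gt0; lra.
have tC : (0 : R[i]) < t%:C by rewrite ltcR.
have := @positive_small (t%:C *: b).
rewrite starZ sb -[Num.conj _]/((t%:C)^*)%C conjc_real => /(_ erefl).
rewrite cnormZ (ger0_norm (ltW tC)) /= (scalarZ phi_lin) normrM (ger0_norm (ltW tC)).
have -> : t * cnorm b = 4^-1 by rewrite /t; field; rewrite gt_eqF.
move=> /(_ (lexx _)) tb.
have -> : (4 * cnorm b)%:C = (t%:C)^-1 by rewrite -fmorphV /t invrK.
by rewrite ler_pdivlMl.
Qed.

(** Split 2 a = h - i k into self-adjoint parts of norm at most 2 ||a||; the self-adjoint bound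
    gives 2 |phi a| <= 16 ||a|| phi 1. The constant is not sharp, but continuity is all that is
    wanted. *)
Lemma positive_bound a : `|phi a| <= (8 * cnorm a)%:C * phi 1.
Proof.
pose h := a + star a; pose k := 'i *: (a - star a).
have sh : star h = h by rewrite /h starD starK addrC.
have sk : star k = k.
  rewrite /k starZ starB starK -[Num.conj _]/('i^*)%C.
  have -> : ('i^* = - 'i :> R[i])%C by apply/eqP; rewrite eq_complex /= oppr0 !eqxx.
  by rewrite scaleNr -scalerN opprB.
have aE : (2 : R[i]) *: a = h - 'i *: k.
  rewrite /k scalerA -expr2 sqr_i scaleN1r opprK /h addrA addrAC -(addrA a).
  by rewrite addrN addr0 scaler_nat mulr2n.
have E : 2 * phi a = phi h - 'i * phi k.
  by rewrite -!(scalarZ phi_lin) -(scalarB phi_lin) aE.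
have n2 : `|2 : R[i]| = 2 by rewrite ger0_norm ?ler0n.
have ni : `|'i : R[i]| = 1 by rewrite normc_def /= expr0n expr1n add0r sqrtr1.
rewrite -(ler_pM2l (ltr0n _ 2)) -{1}n2 -normrM E.
rewrite (le_trans (ler_normB _ _))// normrM ni mul1r.
rewrite (le_trans (lerD (positive_bound_sa sh) (positive_bound_sa sk)))//.
rewrite -mulrDl mulrA ler_wpM2r ?positive1// -rmorphD.
rewrite -(rmorph_nat (real_complex R)) -rmorphM lecR.
have := cnormD a (star a); have := cnormB a (star a).
rewrite /k /h cnormZ ni cnorm_starE /= mul1r; lra.
Qed.

(** This is the parallelogram identity with the nonnegative term at a + b dropped. *)
Lemma positive_para a b :
  phi (star (a - b) * (a - b)) <= 2 * (phi (star a * a) + phi (star b * b)).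
Proof.
have -> : 2 * (phi (star a * a) + phi (star b * b)) =
    phi (star (a - b) * (a - b)) + phi (star (a + b) * (a + b)).
  rewrite -!(scalarD phi_lin) -(scalarZ phi_lin) starB starD.
  congr phi; rewrite scaler_nat mulr2n !mulrDl !mulrDr !mulNr !mulrN opprK.
  set x := star a * a; set y := star a * b; set z := star b * a; set w := star b * b.
  by rewrite addrACA [RHS]addrACA [X in _ = X + _]addrACA [X in _ = _ + X]addrACA
     !addNr addr0 add0r.
by rewrite lerDl phi_pos.2.
Qed.

End Positive.

Lemma positive_eq_closed phi psi : positive phi -> positive psi ->
  cstar_closed [set a | phi a = psi a].
Proof.
move=> p q x l xE /cnorm_cvgP xl /=; apply/eqP; rewrite -subr_eq0 -normr_eq0.
pose C := complex.Re (phi 1 + psi 1).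
have CE : C%:C = phi 1 + psi 1 by rewrite RRe_real// ger0_real// addr_ge0// positive1.
have C0 : 0 <= C by rewrite -lecR CE addr_ge0// positive1.
(* The values at [x n] cancel, which leaves two terms controlled by ||x n - l||. *)
have lE n : phi l - psi l = psi (x n - l) - phi (x n - l).
  by rewrite (scalarB p.1) (scalarB q.1) (xE n) opprB [RHS]addrC addrA addrNK.
have key (e : R) : 0 < e -> `|phi l - psi l| <= (8 * e * C)%:C.
  move=> e0; have [N /(_ N (leqnn N)) xN] := xl e e0.
  rewrite (lE N) (le_trans (ler_normB _ _))//.
  have -> : (8 * e * C)%:C = (8 * e)%:C * (phi 1 + psi 1) by rewrite -CE -rmorphM.
  rewrite mulrDr addrC.
  have h := positive_bound p (x N - l); have h' := positive_bound q (x N - l).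
  rewrite lerD// ?(le_trans h)// ?(le_trans h')// ler_wpM2r ?positive1//.
    by rewrite lecR ler_pM2l// ltW.
  by rewrite lecR ler_pM2l// ltW.
have nr : `|phi l - psi l| = (complex.Re `|phi l - psi l|)%:C by rewrite RRe_real.
rewrite nr in key *; rewrite -[0](rmorph0 (real_complex R)) (inj_eq (@complexI R)).
have n0 : 0 <= complex.Re `|phi l - psi l| by rewrite -(lecR 0) -nr normr_ge0.
rewrite eq_le n0 andbT; apply: (@le0_small _ _ (8 * C)) => e e0.
by have := key e e0; rewrite lecR mulrAC.
Qed.

End Functionals.

(** * Density of the monomials in the noncommutative torus *)

Section Torus.
Context {R : realType} {A : cstarAlgType R}.
Implicit Types (a b u v w : A).

Lemma upow_mull u (m : int) : unitary u -> exists m', u * upow u m = upow u m'.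
Proof.
move=> [su us]; case: m => [n|[|n]].
- by exists n.+1; rewrite /= exprS.
- by exists 0; rewrite /= expr1.
- by exists (Negz n); rewrite /= exprS mulrA us mul1r.
Qed.

Lemma star_upow u (m : int) : unitary u -> star u * upow u m = upow u (m - 1).
Proof.
move=> [su us]; case: m => [[|n]|n].
- by rewrite sub0r /= mulr1 expr1.
- by rewrite -[Posz n.+1 - 1]/(Posz n.+1 - Posz 1) subzn// subn1 /= exprS mulrA su mul1r.
- by rewrite NegzE -opprD -PoszD addn1 -NegzE /= -!exprS.
Qed.

(** Conjugating the relation by the unitary [u] gives the same relation for [star u] with scalar
    c^-1, which covers negative powers. *)
Lemma upow_comm u w c : unitary u -> c != 0 -> w * u = c *: (u * w) ->
  forall m : int, exists d, w * upow u m = d *: (upow u m * w).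
Proof.
move=> [su us] c0 wu.
have wsu : w * star u = c^-1 *: (star u * w).
  apply: (scalerI c0); rewrite scalerA mulfV// scale1r.
  rewrite -[LHS]mul1r -su -mulrA.
  have -> : star u * w = star u * (w * u) * star u by rewrite -!mulrA us mulr1.
  by rewrite wu -!scalerAr -scalerAl -!mulrA.
have expE v d n : w * v = d *: (v * w) -> w * v ^+ n = d ^+ n *: (v ^+ n * w).
  move=> wv; elim: n => [|n IH]; first by rewrite !expr0 scale1r mulr1 mul1r.
  by rewrite exprS mulrA wv -scalerAl -(mulrA v w) IH -scalerAr scalerA mulrA -!exprS.
by case=> n; [exists (c ^+ n); exact: expE | exists (c^-1 ^+ n.+1); exact: expE].
Qed.

Lemma cis_neq0 (t : R) : cis t != 0.
Proof.
rewrite /cis eq_complex /=; apply/negP => /andP[/eqP c /eqP s].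
by have := cos2Dsin2 t; rewrite c s expr0n addr0 => /eqP; rewrite eq_sym oner_eq0.
Qed.

(** [L] is not assumed stable under products. The closed span [N] of the monomials is stable under
    left multiplication by U, V and their adjoints, because of the commutation relation. The
    elements that, with their adjoints, multiply [N] into itself form a C*-subalgebra, hence all of
    [A]; apply them to 1. *)
Lemma nctorus_ind (alpha : R) (U V : A) (L : set A) : is_nctorus alpha U V ->
  cstar_closed L -> (forall (c : R[i]) a b, L a -> L b -> L (c *: a + b)) ->
  (forall m n : int, L (upow U m * upow V n)) -> forall a, L a.
Proof.
move=> [[uU uV UV] gen _] Lc Ll Lm a.
have l0 := cis_neq0 (2 * pi * alpha); set lam := cis _ in UV l0.
pose good (L' : set A) := [/\ cstar_closed L',
  (forall (c : R[i]) a b, L' a -> L' b -> L' (c *: a + b)) &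
  forall m n : int, L' (upow U m * upow V n)].
pose N : set A := [set x | forall L', good L' -> L' x].
have Ncl : cstar_closed N.
  by move=> x l xN xl L' gL'; have [c _ _] := gL'; apply: (c x l) => // n; exact: xN.
have Nl (c : R[i]) x y : N x -> N y -> N (c *: x + y).
  by move=> Nx Ny L' gL'; have [_ h _] := gL'; apply: h; [exact: Nx|exact: Ny].
have Nm m n : N (upow U m * upow V n) by move=> L' [_ _]; exact.
have NZ (c : R[i]) x : N x -> N (c *: x).
  by move=> Nx; have := Nl (c - 1) x x Nx Nx; rewrite scalerBl scale1r subrK.
have cvgMr (z : nat -> A) l x : (fun n => cnorm (z n - l)) @ \oo --> (0 : R) ->
    (fun n => cnorm (z n * x - l * x)) @ \oo --> (0 : R).
  move=> /cnorm_cvgP zl; apply/cnorm_cvgP => e e0.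
  have x1 : 0 < cnorm x + 1 by have := cnorm_ge0 x; lra.
  have [M ME] := zl _ (divr_gt0 e0 x1).
  exists M => n /ME; rewrite ltr_pdivlMr// => h.
  rewrite -mulrBl (le_lt_trans (cnormM _ _))// (le_lt_trans _ h)//.
  by rewrite ler_wpM2l ?cnorm_ge0//; lra.
have cvgMl (z : nat -> A) l x : (fun n => cnorm (z n - l)) @ \oo --> (0 : R) ->
    (fun n => cnorm (x * z n - x * l)) @ \oo --> (0 : R).
  move=> /cnorm_cvgP zl; apply/cnorm_cvgP => e e0.
  have x1 : 0 < cnorm x + 1 by have := cnorm_ge0 x; lra.
  have [M ME] := zl _ (divr_gt0 e0 x1).
  exists M => n /ME; rewrite ltr_pdivlMr// => h.
  rewrite -mulrBr (le_lt_trans (cnormM _ _))// (le_lt_trans _ h)// mulrC.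
  by rewrite ler_wpM2l ?cnorm_ge0//; lra.
have cvgS (z : nat -> A) l : (fun n => cnorm (z n - l)) @ \oo --> (0 : R) ->
    (fun n => cnorm (star (z n) - star l)) @ \oo --> (0 : R).
  move=> zl; apply: cvg_trans zl; apply: near_eq_cvg; apply: nearW => n.
  by rewrite -starB cnorm_starE.
(* The set of x with [N (w * x)] is closed and linear, so by minimality of [N] it is enough to test
   monomials. *)
have stab w : (forall m n : int, N (w * (upow U m * upow V n))) ->
    forall x, N x -> N (w * x).
  move=> wN x Nx; apply: (Nx [set x | N (w * x)]); split.
  - by move=> z l zN /(cvgMl _ _ w); exact: Ncl.
  - by move=> c y z Ny Nz /=; rewrite mulrDr -scalerAr; exact: Nl.
  - exact: wN.
pose S : set A := [set a | (forall x, N x -> N (a * x)) /\ (forall x, N x -> N (star a * x))].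
have SE : S = setT.
  apply: gen.
  - split.
    + move=> z l zS zl; split=> x Nx.
        by apply: (Ncl _ _ _ (cvgMr _ _ x zl)) => n; have [h _] := zS n; exact: h.
      by apply: (Ncl _ _ _ (cvgMr _ _ x (cvgS _ _ zl))) => n; have [_ h] := zS n; exact: h.
    + by split=> x Nx; rewrite ?star1 mul1r.
    + move=> c y z [y1 y2] [z1 z2]; split=> x Nx.
        by rewrite mulrDl -scalerAl; apply: Nl; [exact: y1|exact: z1].
      by rewrite starD starZ mulrDl -scalerAl; apply: Nl; [exact: y2|exact: z2].
    + move=> y z [y1 y2] [z1 z2]; split=> x Nx.
        by rewrite -mulrA; exact: y1 (z1 _ Nx).
      by rewrite starM -mulrA; exact: z2 (y2 _ Nx).
    + by move=> y [y1 y2]; split=> x Nx; rewrite ?starK; [exact: y2|exact: y1].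
  - split; apply: stab => m n; rewrite mulrA.
      by have [m' ->] := upow_mull m uU.
    by rewrite star_upow.
  - have VU : V * U = lam^-1 *: (U * V) by rewrite UV scalerA mulVf// scale1r.
    have sVU : star V * U = lam *: (U * star V).
      have [sV Vs] := uV.
      have -> : star V * U = star V * (U * V) * star V by rewrite -!mulrA Vs mulr1.
      by rewrite UV -scalerAr -scalerAl !mulrA sV mul1r.
    split; apply: stab => m n; rewrite mulrA.
      have [d ->] := upow_comm uU (invr_neq0 l0) VU m.
      by rewrite -scalerAl -mulrA; apply: NZ; have [n' ->] := upow_mull n uV.
    have [d ->] := upow_comm uU l0 sVU m.
    by rewrite -scalerAl -mulrA; apply: NZ; rewrite star_upow.
(* The unit is the monomial with both exponents 0, so a = a * 1 lies in [N], hence in [L]. *)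
have [aS _] : S a by rewrite SE.
have := aS _ (Nm 0 0); rewrite /= !mulr1; exact.
Qed.

Lemma state_ext (alpha : R) (U V : A) (phi psi : A -> R[i]) :
  is_nctorus alpha U V -> positive phi -> positive psi ->
  (forall m n : int, phi (upow U m * upow V n) = psi (upow U m * upow V n)) ->
  phi = psi.
Proof.
move=> T p q H; apply: funext.
apply: (nctorus_ind T (positive_eq_closed p q) _ H) => c a b /= ea eb.
by rewrite p.1 q.1 ea eb.
Qed.

End Torus.


(** * Roots of unity and continuous functions on the circle *)

Section Cis.
Context {R : realType}.
Implicit Types (s t : R) (z w : R[i]).

Lemma cisD s t : cis (s + t) = cis s * cis t.
Proof.
apply/eqP; rewrite /cis eq_complex /= cosD sinD eqxx /=.
by rewrite addrC (mulrC (sin s)).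
Qed.

Lemma cis0 : cis (0 : R) = 1.
Proof. by rewrite /cis cos0 sin0. Qed.

Lemma norm_cis t : `|cis t| = 1.
Proof. by rewrite normc_def /= cos2Dsin2 sqrtr1. Qed.

Lemma cisMn t n : cis t ^+ n = cis (t *+ n).
Proof.
elim: n => [|n IH]; first by rewrite expr0 mulr0n cis0.
by rewrite exprS mulrS cisD IH.
Qed.

Lemma cis2pi : cis (2 * pi : R) = 1.
Proof.
by rewrite /cis mulr2n mulrDl mul1r cosDpi sinDpi cospi sinpi oppr0 opprK.
Qed.

(** Reduce t modulo 2 pi to s in [0, 2 pi). If s > 0 then sin (s / 2) > 0, while cos s = 1 - 2 sin^2
    (s / 2) = 1. *)
Lemma cis_eq1 t : cis t = 1 -> exists k : int, t = k%:~R * (2 * pi).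
Proof.
move=> t1; have p0 : 0 < 2 * pi :> R by rewrite mulr_gt0// pi_gt0.
pose k := Num.floor (t / (2 * pi)); exists k.
have cisk (m : int) : cis (m%:~R * (2 * pi) : R) = 1.
  have cisn n : cis (n%:R * (2 * pi) : R) = 1.
    by rewrite mulr_natl -cisMn cis2pi expr1n.
  case: m => n; first exact: cisn.
  have := cisD (n.+1%:R * (2 * pi)) (- (n.+1%:R * (2 * pi))).
  by rewrite subrr cis0 cisn mul1r NegzE mulrNz mulNr.
pose s := t - k%:~R * (2 * pi).
suff s0 : s = 0 by apply/eqP; rewrite -subr_eq0 -/s s0.
have /andP[k1 k2] : k%:~R <= t / (2 * pi) < (k + 1)%:~R by exact: floor_itv.
have s1 : 0 <= s by rewrite subr_ge0 -ler_pdivlMr.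
have s2 : s < 2 * pi.
  by rewrite ltrBlDr -[X in X + _]mul1r -mulrDl addrC -ltr_pdivrMr// -(intrD _ k 1).
have c1 : cis s = 1.
  by have := cisD s (k%:~R * (2 * pi)); rewrite cisk mulr1 subrK t1.
have {c1} c1 : cos s = 1 by have [] : cis s = 1%:C by [].
apply/eqP; rewrite eq_le s1 andbT leNgt; apply/negP => s0.
have h : 0 < sin (s / 2) by apply: sin_gt0_pi; lra.
have := cosD (s / 2) (s / 2); have := cos2Dsin2 (s / 2).
rewrite -splitr c1 !expr2; have := mulr_gt0 h h; lra.
Qed.

(** If m is the exact order, [cis_eq1] gives m = k M with k a positive integer, so M <= m; and m
    divides M. *)
Lemma unit_root_prim (M : nat) : (0 < M)%N ->
  M.-primitive_root (cis (2 * pi / M%:R : R)).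
Proof.
move=> M0; have MR : M%:R != 0 :> R by rewrite pnatr_eq0 -lt0n.
have wM : cis (2 * pi / M%:R : R) ^+ M = 1.
  by rewrite cisMn -[_ *+ M]mulr_natr divfK// cis2pi.
have [m mp mM] := prim_order_exists M0 wM.
suff Mm : M = m by rewrite [X in X.-primitive_root _]Mm.
apply/eqP; rewrite eqn_leq (dvdn_leq M0 mM) andbT.
have := prim_expr_order mp; rewrite cisMn -[_ *+ m]mulr_natr => /cis_eq1[k].
have p0 : 2 * pi != 0 :> R by rewrite gt_eqF// mulr_gt0// pi_gt0.
rewrite -(mulrA (2 * pi)) mulrC => /(mulIf p0) mk.
have {}mk : m%:R = k%:~R * M%:R :> R by rewrite -mk mulrAC mulVf// mul1r.
have k0 : (0 < k)%R.
  rewrite -(ltr0z R) -(pmulr_lgt0 (x := M%:R)) ?ltr0n// -mk ltr0n.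
  exact: prim_order_gt0 mp.
by rewrite -(ler_nat R) mk ler_peMl ?ler0n// ler1z.
Qed.

(** For 0 < |m| < M the ratio w^m differs from 1, and the geometric sum telescopes to (w^M)^m - 1 =
    0. *)
Lemma prim_root_geom (M : nat) w (m : int) : M.-primitive_root w -> (`|m| < M)%N ->
  \sum_(j < M) (w ^ m) ^+ j = if m == 0 then M%:R else 0.
Proof.
move=> wp mM; case: eqP => [->|/eqP m0].
  rewrite expr0z (eq_bigr (fun=> 1)) => [|j _]; last by rewrite expr1n.
  by rewrite sumr_const card_ord.
have w1 : w ^ m - 1 != 0.
  have h n : (0 < n < M)%N -> w ^+ n != 1.
    case/andP=> n0 nM; rewrite -(prim_order_dvd wp).
    by apply/negP => /(dvdn_leq n0); rewrite leqNgt nM.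
  rewrite subr_eq0; case: m m0 mM => n m0 nM; rewrite ?NegzE ?abszN in nM *.
    by rewrite h// nM andbT lt0n.
  by rewrite -invr_expz invr_eq1 h.
apply: (mulfI w1); rewrite -subrX1 mulr0.
have -> : (w ^ m) ^+ M = (w ^+ M) ^ m by rewrite !exprnP !exprz_exp mulrC.
by rewrite (prim_expr_order wp) exp1rz subrr.
Qed.

Lemma circle_conj z : circle R z -> Num.conj z = z^-1.
Proof.
rewrite /circle /= => z1; have z0 : z != 0 by rewrite -normr_gt0 z1 ltr01.
by apply: (mulfI z0); rewrite -normCK z1 expr1n divff.
Qed.

Lemma circle_neq0 z : circle R z -> z != 0.
Proof. by rewrite /circle /= => z1; rewrite -normr_gt0 z1 ltr01. Qed.

Lemma circleM z w : circle R z -> circle R w -> circle R (z * w).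
Proof. by rewrite /circle /= normrM => -> ->; rewrite mulr1. Qed.

Lemma circleX z n : circle R z -> circle R (z ^+ n).
Proof. by rewrite /circle /= normrX => ->; rewrite expr1n. Qed.

Lemma circle_conjC z : circle R z -> circle R (Num.conj z).
Proof. by rewrite /circle /= norm_conjC. Qed.

Lemma circle_cis t : circle R (cis t).
Proof. exact: norm_cis. Qed.

Lemma circle_cisP z : circle R z -> exists2 t, - pi <= t <= pi & z = cis t.
Proof.
case: z => a b; rewrite /circle /= normc_def /= => /complexI /eqP h.
have ab : a ^+ 2 + b ^+ 2 = 1.
  rewrite -[LHS]sqr_sqrtr ?addr_ge0 ?sqr_ge0//.
  by move/eqP: h => ->; rewrite expr1n.
have a1 : -1 <= a <= 1.
  rewrite -ler_norml -(ler_pXn2r (n := 2)) ?nnegrE// expr1n real_normK ?num_real//.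
  by rewrite -ab lerDl sqr_ge0.
have p0 := acos_ge0 a1; have p1 := acos_lepi a1.
have bE : Num.sqrt (1 - a ^+ 2) = `|b| by rewrite -ab addrC addKr sqrtr_sqr.
case: (leP 0 b) => b0.
  exists (acos a); first by rewrite p1 andbT (le_trans _ p0)// oppr_le0 pi_ge0.
  by rewrite /cis sin_acos// acosK// bE ger0_norm.
exists (- acos a).
  by rewrite lerN2 p1 (le_trans _ (pi_ge0 R))// oppr_le0.
by rewrite /cis cosN sinN sin_acos// acosK// bE ltr0_norm// opprK.
Qed.

Lemma normcE_le z : `|z| <= (`|complex.Re z| + `|complex.Im z|)%:C.
Proof.
case: z => a b; rewrite normc_def lecR /=.
rewrite -(ler_pXn2r (n := 2)) ?nnegrE ?sqrtr_ge0 ?addr_ge0//.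
rewrite sqr_sqrtr ?addr_ge0 ?sqr_ge0// sqrrD !real_normK ?num_real//.
by rewrite -addrA lerD2l lerDr mulrn_wge0// mulr_ge0.
Qed.

Lemma Re_le_norm z : (`|complex.Re z|)%:C <= `|z|.
Proof. exact: normc_ge_Re. Qed.

Lemma gt0_complexE (e : R[i]) : 0 < e -> exists2 d : R, 0 < d & e = d%:C.
Proof.
by case: e => a b; rewrite ltcE /= => /andP[/eqP -> a0]; exists a.
Qed.

Lemma cis_continuous : continuous (@cis R : R -> R[i]^o).
Proof.
move=> t; apply/cvgrPdist_lt => _ /gt0_complexE[e e0 ->].
have e2 : 0 < e / 2 by rewrite divr_gt0.
have := @continuous_cos R t; move=> /cvgrPdist_lt/(_ _ e2) H1.
have := @continuous_sin R t; move=> /cvgrPdist_lt/(_ _ e2) H2.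
near=> s; apply: (le_lt_trans (normcE_le _)); rewrite ltcR /=.
rewrite [ltRHS](splitr e) ltrD//; near: s; [exact: H1|exact: H2].
Unshelve. all: by end_near.
Qed.

Lemma compact_circle : compact (circle R : set R[i]^o).
Proof.
have -> : (circle R : set R[i]^o) = @cis R @` `[- pi, pi].
  apply/seteqP; split=> [z /circle_cisP[t tI ->]|_ [t _ <-]].
    by exists t => //=; rewrite in_itv.
  exact: circle_cis.
apply: continuous_compact; last exact: segment_compact.
by apply: continuous_subspaceT => t; exact: cis_continuous.
Qed.

End Cis.

Section CircleContinuous.
Context {R : realType}.
Implicit Types (g h : R[i] -> R[i]) (z w : R[i]).

Lemma circle_continuousP g : circle_continuous g <->
  forall z, circle R z ->
    (g : R[i]^o -> R[i]^o) x @[x --> within (circle R : set R[i]^o) (nbhs (z : R[i]^o))]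
      --> (g z : R[i]^o).
Proof. exact: subspace_continuousP. Qed.

Lemma circle_continuous_cst (c : R[i]) : circle_continuous (fun=> c).
Proof. by apply/circle_continuousP => z _; exact: cvg_cst. Qed.

Lemma circle_continuous_id : circle_continuous (id : R[i] -> R[i]).
Proof. by apply/circle_continuousP => z _; exact: cvg_within. Qed.

Lemma circle_continuousD g h : circle_continuous g -> circle_continuous h ->
  circle_continuous (fun z => g z + h z).
Proof.
move=> /circle_continuousP cg /circle_continuousP ch; apply/circle_continuousP => z Cz.
by apply: (@cvgD _ R[i]^o); [exact: cg|exact: ch].
Qed.

Lemma circle_continuousM g h : circle_continuous g -> circle_continuous h ->
  circle_continuous (fun z => g z * h z).
Proof.
move=> /circle_continuousP cg /circle_continuousP ch; apply/circle_continuousP => z Cz.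
by apply: (@cvgM R[i]); [exact: cg|exact: ch].
Qed.

Lemma circle_continuous_comp g (s : R[i] -> R[i]) :
  circle_continuous g -> continuous (s : R[i]^o -> R[i]^o) ->
  circle_continuous (fun z => s (g z)).
Proof.
move=> /circle_continuousP cg cs; apply/circle_continuousP => z Cz.
exact: (continuous_cvg _ (cs _) (cg _ Cz)).
Qed.

Lemma conj_continuous : continuous ((@Num.conj R[i]) : R[i]^o -> R[i]^o).
Proof.
move=> z; have FF : Filter (nbhs (z : R[i]^o)) by exact: nbhs_filter.
apply/cvgrPdist_lt => e e0.
near=> w; rewrite -rmorphB norm_conjC; near: w.
exact: (@cvgrPdist_lt _ R[i]^o _ _ _ id z).1.
Unshelve. all: by end_near.
Qed.

Lemma circle_continuous_conj g : circle_continuous g ->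
  circle_continuous (fun z => Num.conj (g z)).
Proof. by move=> cg; exact: circle_continuous_comp cg conj_continuous. Qed.

Lemma sqrt_Re_continuous :
  continuous ((fun z => (Num.sqrt (complex.Re z))%:C) : R[i]^o -> R[i]^o).
Proof.
move=> z; have FF : Filter (nbhs (z : R[i]^o)) by exact: nbhs_filter.
apply/cvgrPdist_lt => _ /gt0_complexE[e e0 ->].
have /cvgrPdist_lt/(_ _ e0) := @sqrt_continuous R (complex.Re z).
case=> d /= d0 dP; have dC : (0 : R[i]) < d%:C by rewrite ltcR.
have /cvgrPdist_lt/(_ _ dC) : (w : R[i]^o) @[w --> (z : R[i]^o)] --> (z : R[i]^o) by exact: cvg_id.
apply: filterS => w zw.
rewrite -rmorphB (le_lt_trans (normcE_le _))//= normr0 addr0 ltcR; apply: dP => /=.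
rewrite -ltcR (le_lt_trans _ zw)// (le_trans _ (Re_le_norm _))//.
by rewrite raddfB.
Qed.

(* Uniform continuity on the circle, in the quantitative form that makes
   Korovkin's argument work. *)
Lemma circle_continuous_modulus g (e : R) : circle_continuous g ->
  (forall z, circle R z -> `|g z| <= 1) -> 0 < e ->
  exists2 C : R, 0 <= C & forall z w, circle R z -> circle R w ->
    `|g z - g w| <= e%:C + C%:C * `|z - w| ^+ 2.
Proof.
move=> /circle_continuousP cg g1 e0.
have /compact_near_coveringP/near_covering_withinP K := @compact_circle R.
pose P (d : R) z := forall w, circle R w -> `|z - w| < d%:C -> `|g z - g w| <= e%:C.
have [z Cz|d /= d0 dP] := K _ (0^'+) P _.
  have e2 : (0 : R[i]) < (e / 2)%:C by rewrite ltcR divr_gt0.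
  have /cvgrPdist_lt/(_ _ e2) := cg z Cz.
  rewrite near_withinE => -[_ /= /gt0_complexE[r r0 ->] rP].
  have r2 : 0 < r / 2 by rewrite divr_gt0.
  (* If z' is within r/2 of z and w within d < r/2 of z', both lie within r of z, where g varies by
     less than e/2. *)
  exists ((ball (z : R[i]^o) (r / 2)%:C : set R[i]^o), [set d | d < r / 2]).
    split; first by apply: nbhsx_ballx; rewrite ltcR.
    exact: nbhs_right_lt.
  case=> z' d /= [zz' dr] Cz' w Cw z'w.
  rewrite -ball_normE /= in zz'.
  have h1 : `|g z - g z'| < (e / 2)%:C.
    apply: rP => //; rewrite /ball_ /= (lt_trans zz')// ltcR; lra.
  have h2 : `|g z - g w| < (e / 2)%:C.
    apply: rP => //; rewrite /ball_ /=.
    rewrite -[z - w](subrKA z') (le_lt_trans (ler_normD _ _))//.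
    by rewrite (splitr r) rmorphD ltrD// (lt_trans z'w)// ltcR.
  rewrite -[g z' - g w](subrKA (g z)) (le_trans (ler_normD _ _))//.
  by rewrite (splitr e) rmorphD lerD// ltW// distrC.
have d2 : 0 < d / 2 by rewrite divr_gt0.
have := dP (d / 2); rewrite /= sub0r normrN gtr0_norm//.
move=> /(_ ltac:(lra) d2) {}dP.
(* When |z - w| >= d/2 the quadratic term is at least 2, which dominates |g z - g w| because |g| <=
   1. *)
exists (2 / (d / 2) ^+ 2); first by rewrite divr_ge0// exprn_ge0// ltW.
move=> z w Cz Cw; case: (boolP (`|z - w| < (d / 2)%:C)) => h.
  rewrite (le_trans (dP z Cz w Cw h))// lerDl mulr_ge0// ?exprn_ge0//.
  by rewrite ler0c divr_ge0// exprn_ge0// ltW.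
have {}h : (d / 2)%:C <= `|z - w|.
  by rewrite real_leNgt// ger0_real// ler0c ltW.
apply: (@le_trans _ _ (1 + 1)).
  by rewrite (le_trans (ler_normB _ _))// lerD ?g1.
apply: ler_wpDl; first by rewrite ler0c ltW.
rewrite rmorphM fmorphV rmorphXn /= mulrAC. rewrite ler_pdivlMr ?exprn_gt0 ?ltcR//.
by rewrite rmorph_nat ler_pM2l ?ltr0n// lerXn2r// nnegrE// ler0c ltW.
Qed.

End CircleContinuous.


(** * Trigonometric approximation and the functional calculus *)

Section TrigPoly.
Context {R : realType}.
Implicit Types (p q : R[i] -> R[i]) (z w y : R[i]).

(** The constructors mirror the fields of [is_calculus], so that two calculi at the same element
    agree on these functions by induction. *)
Inductive trig_poly : (R[i] -> R[i]) -> Prop :=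
| trig_one : trig_poly (fun=> 1)
| trig_id : trig_poly id
| trig_lin (c : R[i]) p q : trig_poly p -> trig_poly q -> trig_poly (fun z => c * p z + q z)
| trig_mul p q : trig_poly p -> trig_poly q -> trig_poly (fun z => p z * q z)
| trig_conj p : trig_poly p -> trig_poly (fun z => Num.conj (p z)).

Lemma trig_poly_continuous p : trig_poly p -> circle_continuous p.
Proof.
elim=> {p} [||c p q _ cp _ cq|p q _ cp _ cq|p _ cp].
- exact: circle_continuous_cst.
- exact: circle_continuous_id.
- exact: (circle_continuousD (circle_continuousM (@circle_continuous_cst R c) cp) cq).
- exact: circle_continuousM.
- exact: circle_continuous_conj.
Qed.

Lemma trig_scale c p : trig_poly p -> trig_poly (fun z => c * p z).
Proof.
move=> tp; have := trig_lin (c - 1) tp tp; congr trig_poly; apply/funext => z.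
by rewrite mulrBl mul1r subrK.
Qed.

Lemma trig_cst c : trig_poly (fun=> c).
Proof.
by have := trig_scale c trig_one; congr trig_poly; apply/funext => z; rewrite mulr1.
Qed.

Lemma trig_add p q : trig_poly p -> trig_poly q -> trig_poly (fun z => p z + q z).
Proof.
move=> tp tq; have := trig_lin 1 tp tq; congr trig_poly; apply/funext => z.
by rewrite mul1r.
Qed.

Lemma trig_exp p n : trig_poly p -> trig_poly (fun z => p z ^+ n).
Proof.
move=> tp; elim: n => [|n IH]; first exact: trig_one.
have := trig_mul tp IH; congr trig_poly; apply/funext => z; by rewrite exprS.
Qed.

Lemma trig_sum (I : Type) (r : seq I) (F : I -> R[i] -> R[i]) :
  (forall i, trig_poly (F i)) -> trig_poly (fun z => \sum_(i <- r) F i z).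
Proof.
move=> tF; elim: r => [|i r IH].
  by have := trig_cst 0; congr trig_poly; apply/funext => z; rewrite big_nil.
by have := trig_add (tF i) IH; congr trig_poly; apply/funext => z; rewrite big_cons.
Qed.

(** This is |1 + y|^(2n), which on the circle peaks at y = 1; written with the conjugate, it is
    visibly a trigonometric polynomial. *)
Definition korovkin_kernel n y : R[i] := ((1 + y) * (1 + Num.conj y)) ^+ n.

Lemma conjC_add1 y : Num.conj (1 + y) = 1 + Num.conj y.
Proof. by rewrite rmorphD rmorph1. Qed.

Lemma conjC_sub1 y : Num.conj (1 - y) = 1 - Num.conj y.
Proof. by rewrite rmorphB rmorph1. Qed.

Lemma korovkin_kernel_ge0 n y : 0 <= korovkin_kernel n y.
Proof.
by rewrite /korovkin_kernel -conjC_add1 exprn_ge0// mul_conjC_ge0.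
Qed.

(** On the circle the kernel equals (1 + y)^(2n) / y^n, with exponents i - n between -n and n. As n
    < M, summing over the M-th roots of unity keeps only the constant coefficient, whatever z is. *)
Lemma korovkin_kernel_sum (n M : nat) w z : M.-primitive_root w -> circle R w -> circle R z ->
  (n < M)%N ->
  \sum_(j < M) korovkin_kernel n (z * w ^+ j) = M%:R * 'C(n.*2, n)%:R.
Proof.
move=> wp Cw Cz nM.
have z0 := circle_neq0 Cz; have w0 := circle_neq0 Cw.
pose F (i : 'I_n.*2.+1) : R[i] := 'C(n.*2, i)%:R * (z ^+ i / z ^+ n).
have KE (j : nat) : korovkin_kernel n (z * w ^+ j) =
    \sum_(i < n.*2.+1) F i * (w ^ (i%:Z - n%:Z)) ^+ j.
  set y := z * w ^+ j.
  have Cy : circle R y by apply: circleM => //; exact: circleX.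
  have y0 := circle_neq0 Cy.
  rewrite /korovkin_kernel circle_conj//.
  have -> : (1 + y) * (1 + y^-1) = (1 + y) ^+ 2 / y by field.
  rewrite expr_div_n -exprM mul2n exprDn mulr_suml; apply: eq_bigr => i _.
  rewrite expr1n mul1r /F -mulr_natl -!mulrA; congr (_ * _).
  rewrite /y !exprMn expfzDr// -invr_expz -!exprnP exprMn exprVn.
  rewrite -!exprM (mulnC j) (mulnC j) invfM.
  by field; rewrite !expf_neq0.
under eq_bigr do rewrite KE.
rewrite exchange_big /=.
have nn : (n < n.*2.+1)%N by rewrite ltnS -addnn leq_addr.
rewrite (bigD1 (Ordinal nn))//= [X in _ + X]big1 => [|i /negP iN].
  rewrite -mulr_sumr prim_root_geom// ?subrr ?absz0 ?(leq_ltn_trans _ nM)//.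
  by rewrite eqxx addr0 /F /= divff ?expf_neq0// mulr1 mulrC.
rewrite -mulr_sumr (prim_root_geom wp).
  rewrite subr_eq0; case: eqP => [[iE]|_]; last by rewrite mulr0.
  by exfalso; apply: iN; apply/eqP/val_inj.
have := ltn_ord i; lia.
Qed.

(** The ratio of consecutive central binomial coefficients; it evaluates the second moment in
    [trig_approx]. *)
Lemma central_bin n : (n.+1 * 'C(n.+1.*2, n.+1) = 2 * (n.*2.+1 * 'C(n.*2, n)))%N.
Proof.
rewrite doubleS binS.
have -> : 'C(n.*2.+1, n) = 'C(n.*2.+1, n.+1).
  by rewrite -[in RHS]bin_sub ?subSS -?addnn ?addnK// ltnS leq_addr.
by have /= -> := mul_bin_diag n.*2.+1 n; rewrite mulnDr addnn mul2n.
Qed.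

(* Discrete Korovkin argument: the weights [korovkin_kernel n (conj z * w ^+ j)], j < M,
   normalised to total mass 1, have second moment 2 / (n + 1) about z. *)
Lemma trig_approx (f : R[i] -> R[i]) (e : R) : circle_continuous f ->
  (forall z, circle R z -> `|f z| <= 1) -> 0 < e ->
  exists2 p, trig_poly p & forall z, circle R z -> `|f z - p z| <= e%:C.
Proof.
move=> cf f1 e0; have e2 : 0 < e / 2 by rewrite divr_gt0.
have [C C0 fC] := circle_continuous_modulus cf f1 e2.
(* This makes the second-moment contribution C * 2 / (n + 1) at most e/2. *)
have [n nP] : exists n : nat, 4 * C / e < n.+1%:R.
  by exists (Num.truncn (4 * C / e)); exact: truncnS_gt.
(* The moment computation also sums the kernel of index n + 1, which requires n + 1 < M. *)
pose M := n.+2.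
pose w : R[i] := cis (2 * pi / M%:R).
have wp : M.-primitive_root w by exact: unit_root_prim.
have Cw : circle R w by exact: circle_cis.
pose c : R[i] := (M%:R * 'C(n.*2, n)%:R)^-1.
have bin0 : ('C(n.*2, n)%:R : R[i]) != 0.
  by rewrite pnatr_eq0 -lt0n bin_gt0 -addnn leq_addr.
have M0 : (M%:R : R[i]) != 0 by rewrite pnatr_eq0.
pose E (j : 'I_M) z : R[i] := c * korovkin_kernel n (Num.conj z * w ^+ j).
have E0 j z : 0 <= E j z.
  by rewrite mulr_ge0 ?korovkin_kernel_ge0// invr_ge0 mulr_ge0// ler0n.
have E1 z : circle R z -> \sum_j E j z = 1.
  move=> Cz; rewrite -mulr_sumr (korovkin_kernel_sum wp)// ?mulVf ?mulf_neq0//.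
  exact: circle_conjC.
have moment z : circle R z -> \sum_j E j z * `|z - w ^+ j| ^+ 2 = 2 / n.+1%:R.
  move=> Cz; have Cz' := circle_conjC Cz.
  have zz : z * Num.conj z = 1 by rewrite circle_conj// divff// circle_neq0.
  (* On the circle |1 - y|^2 = 4 - |1 + y|^2, and the factor |1 + y|^2 raises the index of the
     kernel by one. *)
  have dist (j : 'I_M) : E j z * `|z - w ^+ j| ^+ 2 =
      4 * E j z - c * korovkin_kernel n.+1 (Num.conj z * w ^+ j).
    set y := Num.conj z * w ^+ j.
    have Cy : circle R y by apply: circleM => //; exact: circleX.
    have -> : z - w ^+ j = z * (1 - y) by rewrite mulrBr mulr1 /y mulrA zz mul1r.
    rewrite normrM Cz mul1r normCK conjC_sub1 /E -/y /korovkin_kernel exprS circle_conj//.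
    by field; exact: circle_neq0.
  rewrite (eq_bigr _ (fun j _ => dist j)) sumrB -[X in _ - X]mulr_sumr (korovkin_kernel_sum wp)//.
  have -> : \sum_j 4 * E j z = 4 * \sum_j E j z by rewrite mulr_sumr.
  rewrite E1// mulr1.
  have := central_bin n => /(congr1 (fun k => k%:R : R[i])); rewrite !natrM => cb.
  have n0 : (n.+1%:R : R[i]) != 0 by rewrite pnatr_eq0.
  apply: (mulfI n0); rewrite [RHS]mulrCA divff// mulr1 mulrBr /c invfM.
  have -> : n.+1%:R * (M%:R^-1 * 'C(n.*2, n)%:R^-1 * (M%:R * 'C(n.+1.*2, n.+1)%:R)) =
     'C(n.*2, n)%:R^-1 * (n.+1%:R * 'C(n.+1.*2, n.+1)%:R) :> R[i].
    by field; rewrite M0 bin0.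
  rewrite cb; have -> : n.*2.+1%:R = 2 * n%:R + 1 :> R[i] by rewrite -natr1 -mul2n natrM.
  by rewrite -natr1; field; exact: bin0.
exists (fun z => \sum_(j < M) f (w ^+ j) * E j z).
  apply: trig_sum => j; apply/trig_scale/trig_scale/trig_exp.
  have t : trig_poly (fun z => Num.conj z * w ^+ j).
    by apply: trig_mul; [exact/trig_conj/trig_id|exact: trig_cst].
  exact: (trig_mul (trig_add trig_one t) (trig_add trig_one (trig_conj t))).
move=> z Cz.
have -> : f z - \sum_(j < M) f (w ^+ j) * E j z = \sum_(j < M) (f z - f (w ^+ j)) * E j z.
  by under [RHS]eq_bigr do rewrite mulrBl; rewrite sumrB -mulr_sumr E1// mulr1.
apply: (le_trans (ler_norm_sum _ _ _)).
apply: (@le_trans _ _ (\sum_(j < M) ((e / 2)%:C * E j z + C%:C * (E j z * `|z - w ^+ j| ^+ 2)))).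
  apply: ler_sum => j _; rewrite normrM (ger0_norm (E0 _ _)).
  rewrite [X in _ <= _ + X]mulrCA [X in _ <= _ + X]mulrC -mulrDl ler_wpM2r// fC//.
  exact: circleX.
rewrite big_split /= -[X in X + _ <= _]mulr_sumr -[X in _ + X <= _]mulr_sumr E1// moment// mulr1.
rewrite -(rmorph_nat (real_complex R)) -[n.+1%:R](rmorph_nat (real_complex R)).
rewrite -fmorphV -!rmorphM -rmorphD lecR.
have n0 : (n.+1%:R : R) != 0 by rewrite pnatr_eq0.
move: nP; rewrite ltr_pdivrMr// => h.
have -> : C * (2 / n.+1%:R) = (4 * C) / n.+1%:R / 2 
  by move: n0; move: (n.+1%:R : R) => m m0; field.
rewrite [leRHS](splitr e) lerD2l ler_pM2r ?invr_gt0// ler_pdivrMr ?ltr0n//.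
by rewrite (mulrC e) ltW.
Qed.

End TrigPoly.

Section Calculus.
Context {R : realType} {A : cstarAlgType R}.
Implicit Types (u : A) (rho : (R[i] -> R[i]) -> A) (g f : R[i] -> R[i]).

Lemma calculus_cst u rho (c : R[i]) : is_calculus u rho -> rho (fun=> c) = c *: 1.
Proof.
move=> cr; have c1 := @circle_continuous_cst R 1.
rewrite (_ : (fun=> c) = fun z => (c - 1) * (fun=> 1) z + (fun=> 1) z); last first.
  by apply/funext => z; rewrite mulr1 subrK.
by rewrite (calculus_linear cr _ c1 c1) (calculus_one cr) scalerBl scale1r subrK.
Qed.

Lemma calculus_trig u rho1 rho2 p : is_calculus u rho1 -> is_calculus u rho2 ->
  trig_poly p -> rho1 p = rho2 p.
Proof.
move=> c1 c2; elim=> {p} [||c p q tp ep tq eq|p q tp ep tq eq|p tp ep].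
- by rewrite (calculus_one c1) (calculus_one c2).
- by rewrite (calculus_id c1) (calculus_id c2).
- have cp := trig_poly_continuous tp; have cq := trig_poly_continuous tq.
  by rewrite (calculus_linear c1 _ cp cq) (calculus_linear c2 _ cp cq) ep eq.
- have cp := trig_poly_continuous tp; have cq := trig_poly_continuous tq.
  by rewrite (calculus_mul c1 cp cq) (calculus_mul c2 cp cq) ep eq.
- have cp := trig_poly_continuous tp.
  by rewrite (calculus_star c1 cp) (calculus_star c2 cp) ep.
Qed.

Lemma calculusB u rho f g : is_calculus u rho -> circle_continuous f ->
  circle_continuous g -> rho (fun z => f z - g z) = rho f - rho g.
Proof.
move=> cr cf cg; rewrite -[in RHS]scaleN1r addrC -(calculus_linear cr _ cg cf).
by congr rho; apply/funext => z; rewrite mulN1r addrC.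
Qed.

(* e^2 - |g|^2 is the square of a continuous real function, so its image
   under rho is of the form k^* k. *)
Lemma calculus_bound u rho (phi : A -> R[i]) g (e : R) : is_calculus u rho ->
  positive phi -> circle_continuous g ->
  (forall z, circle R z -> `|g z| <= e%:C) ->
  phi (star (rho g) * rho g) <= (e ^+ 2)%:C * phi 1.
Proof.
move=> cr pp cg ge.
pose r z : R[i] := (-1) * (Num.conj (g z) * g z) + (e ^+ 2)%:C.
pose k z : R[i] := (Num.sqrt (complex.Re (r z)))%:C.
have cg' := circle_continuous_conj cg.
have cgg := circle_continuousM cg' cg.
have ce := @circle_continuous_cst R (e ^+ 2)%:C.
have crr : circle_continuous r.
  exact: (circle_continuousD (circle_continuousM (@circle_continuous_cst R (-1)) cgg) ce).
have ck : circle_continuous k := circle_continuous_comp crr (@sqrt_Re_continuous R).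
(* The two functions agree on the circle, where r >= 0; elsewhere [Num.sqrt] may meet a negative
   number and return 0, which [calculus_ext] ignores. *)
have kk : rho (fun z => Num.conj (k z) * k z) = rho r.
  apply: (calculus_ext cr (circle_continuousM (circle_continuous_conj ck) ck) crr).
  move=> z; rewrite inE => Cz.
  have r0 : 0 <= r z.
    rewrite /r mulN1r addrC subr_ge0 mulrC -normCK rmorphXn/=.
    by rewrite lerXn2r ?nnegrE ?ge// (le_trans _ (ge z Cz)).
  rewrite [Num.conj _]conjc_real -rmorphM -expr2 sqr_sqrtr.
    exact: RRe_real (ger0_real r0).
  by move: r0; rewrite lecE => /andP[_].
have := pp.2 (rho k); rewrite -(calculus_star cr ck).
rewrite -(calculus_mul cr (circle_continuous_conj ck) ck).
rewrite kk (calculus_linear cr _ cgg ce) (calculus_cst _ cr) (calculus_mul cr cg' cg).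
rewrite (calculus_star cr cg) pp.1 (scalarZ pp.1) mulN1r addrC subr_ge0; exact.
Qed.

(** Both calculi agree on a trigonometric polynomial p close to f, so the difference [D] at f equals
    the difference at f - p. [calculus_bound] and [positive_para] give phi (star D * D) <= 4 e^2 phi
    1 for every e > 0, and faithfulness yields D = 0. *)
Lemma calculus_unique u rho1 rho2 (phi : A -> R[i]) f :
  is_calculus u rho1 -> is_calculus u rho2 ->
  positive phi -> (forall a, phi (star a * a) = 0 -> a = 0) ->
  circle_continuous f -> (forall z, circle R z -> `|f z| <= 1) ->
  rho1 f = rho2 f.
Proof.
move=> c1 c2 pp faith cf f1; apply/eqP; rewrite -subr_eq0; apply/eqP; apply: faith.
set D := rho1 f - rho2 f.
have D0 := pp.2 D; have p1 := positive1 pp.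
have key (e : R) : 0 < e -> phi (star D * D) <= (4 * e ^+ 2)%:C * phi 1.
  move=> e0; have [p tp fp] := trig_approx cf f1 e0.
  have cp := trig_poly_continuous tp.
  pose g z := f z - p z.
  have cg : circle_continuous g.
    have := circle_continuousD cf (circle_continuousM (@circle_continuous_cst R (-1)) cp).
    by congr circle_continuous; apply/funext => z; rewrite mulN1r.
  have -> : D = rho1 g - rho2 g.
    by rewrite (calculusB c1 cf cp) (calculusB c2 cf cp) (calculus_trig c1 c2 tp) opprB addrA subrK.
  apply: (le_trans (positive_para pp _ _)).
  apply: (@le_trans _ _ (2 * ((e ^+ 2)%:C * phi 1 + (e ^+ 2)%:C * phi 1))).
    by rewrite ler_pM2l// lerD//; [apply: (calculus_bound c1)|apply: (calculus_bound c2)].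
  have -> : (4 * e ^+ 2)%:C = 4 * (e ^+ 2)%:C.
    by rewrite -(rmorph_nat (real_complex R) 4) -rmorphM.
  by rewrite le_eqVlt; apply/orP; left; apply/eqP; ring.
have DE : phi (star D * D) = (complex.Re (phi (star D * D)))%:C.
  by rewrite RRe_real// ger0_real.
have pE : phi 1 = (complex.Re (phi 1))%:C by rewrite RRe_real// ger0_real.
apply/eqP; rewrite eq_le D0 andbT DE lecR.
apply: (@le0_small _ _ (4 * complex.Re (phi 1))) => d d0.
have := key (Num.sqrt d); rewrite sqrtr_gt0 => /(_ d0).
have -> : (4 * Num.sqrt d ^+ 2)%:C * phi 1 = (4 * complex.Re (phi 1) * d)%:C.
  by rewrite sqr_sqrtr ?ltW// [in LHS]pE -[LHS]rmorphM mulrAC.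
by rewrite DE lecR.
Qed.

(** Since h fixes u, [h \o rho] is again a calculus at u, and uniqueness applies. *)
Lemma calculus_fixed u rho (phi : A -> R[i]) f (h : {lrmorphism A -> A}) :
  is_calculus u rho ->
  positive phi -> (forall a, phi (star a * a) = 0 -> a = 0) ->
  circle_continuous f -> (forall z, circle R z -> `|f z| <= 1) ->
  star_preserving h -> h u = u -> h (rho f) = rho f.
Proof.
move=> cr pp faith cf f1 hs hu.
apply: (@calculus_unique u (h \o rho) rho phi) => //; split=> /=.
- by move=> g g' cg cg' gg'; rewrite (calculus_ext cr cg cg' gg').
- by move=> c g g' cg cg'; rewrite (calculus_linear cr)// linearP.
- by move=> g g' cg cg'; rewrite (calculus_mul cr)// rmorphM.
- by move=> g cg; rewrite (calculus_star cr).
- by rewrite (calculus_one cr) rmorph1.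
- by rewrite (calculus_id cr).
Qed.

End Calculus.

(** * Ultralimits of sequences of states *)

Section UltraLimit.
Context {R : realType}.

Lemma Im_le_norm (z : R[i]) : (`|complex.Im z|)%:C <= `|z|.
Proof. by rewrite normc_def lecR -sqrtr_sqr ler_wsqrtr// lerDr sqr_ge0. Qed.

(** Compactness of [-M, M] provides a cluster point, and an ultrafilter converges to each of its
    cluster points. *)
Lemma ultra_bounded_cvg (T : Type) (F : set_system T) (x : T -> R) (M : R) :
  UltraFilter F -> (forall n, `|x n| <= M) -> exists l : R, x n @[n --> F] --> l.
Proof.
move=> UF xM.
have [l [_ Cl]] : `[(- M), M]%classic `&` cluster (x n @[n --> F]) !=set0.
  apply: (@segment_compact R (- M) M).
  have : F [set n | `[(- M), M]%classic (x n)]; last exact.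
  by apply: filterE => n; rewrite /= in_itv /= -ler_norml.
exists l => B lB; have [//|FB] := in_ultra_setVsetC (x @^-1` B) UF.
by have [y [nBy By]] := Cl (~` B) B FB lB.
Qed.

(** This stands in for weak-* compactness of the state space. [positive_bound] bounds each sequence
    of values, so it converges along an ultrafilter finer than [eventually]; eventually constant
    values are kept by the limit. *)
Lemma ultralimit_state (A : cstarAlgType R) (phi : nat -> A -> R[i]) :
  (forall n, is_state (phi n)) ->
  exists2 psi : A -> R[i], is_state psi &
    forall a c, (exists N, forall n, (N <= n)%N -> phi n a = c) -> psi a = c.
Proof.
move=> st; have [F [UF oF]] := ultraFilterLemma eventually_filter.
pose L a (l : R[i]) := complex.Re (phi n a) @[n --> F] --> complex.Re l /\
  complex.Im (phi n a) @[n --> F] --> complex.Im l.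
have Lex a : exists l, L a l.
  have bnd n : `|phi n a| <= (8 * cnorm a)%:C.
    have := positive_bound (state_positive (st n)) a.
    by have [_ _ ->] := st n; rewrite mulr1.
  have [p Lp] : exists l : R, complex.Re (phi n a) @[n --> F] --> l.
    apply: (@ultra_bounded_cvg _ _ _ (8 * cnorm a)) => n.
    by rewrite -lecR (le_trans (Re_le_norm _)).
  have [q Lq] : exists l : R, complex.Im (phi n a) @[n --> F] --> l.
    apply: (@ultra_bounded_cvg _ _ _ (8 * cnorm a)) => n.
    by rewrite -lecR (le_trans (Im_le_norm _)).
  by exists (p +i* q).
have Lun a l l' : L a l -> L a l' -> l = l'.
  case: l l' => [p q] [p' q'] [/= h1 h2] [/= h3 h4].
  by rewrite (cvg_unique _ h1 h3)// (cvg_unique _ h2 h4).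
have [psi psiP] := choice Lex.
have ev a c : (exists N, forall n, (N <= n)%N -> phi n a = c) -> psi a = c.
  move=> [N NP]; apply: (Lun a) => //.
  have FN : \forall n \near F, phi n a = c by apply: oF; exists N.
  by split; (apply: cvg_near_cst; apply: filterS FN => n ->).
exists psi => //; split.
- move=> c a b; apply: (Lun _ _ _ (psiP _)).
  have [a1 a2] := psiP a; have [b1 b2] := psiP b.
  have E n : phi n (c *: a + b) = c * phi n a + phi n b by have [+ _ _] := st n; exact.
  split.
    rewrite (_ : complex.Re (c * psi a + psi b) = complex.Re c * complex.Re (psi a)
       - complex.Im c * complex.Im (psi a) + complex.Re (psi b)); last first.
      by case: (c) (psi a) (psi b) => ? ? [? ?] [? ?].
    rewrite (_ : (fun n => _) = (fun n => complex.Re c * complex.Re (phi n a)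
       - complex.Im c * complex.Im (phi n a) + complex.Re (phi n b))); last first.
      by apply/funext => n; rewrite E; case: (c) (phi n a) (phi n b) => ? ? [? ?] [? ?].
    by apply: cvgD b1; apply: cvgB; apply: cvgM => //; exact: cvg_cst.
  rewrite (_ : complex.Im (c * psi a + psi b) = complex.Re c * complex.Im (psi a)
     + complex.Im c * complex.Re (psi a) + complex.Im (psi b)); last first.
    by case: (c) (psi a) (psi b) => ? ? [? ?] [? ?].
  rewrite (_ : (fun n => _) = (fun n => complex.Re c * complex.Im (phi n a)
     + complex.Im c * complex.Re (phi n a) + complex.Im (phi n b))); last first.
    by apply/funext => n; rewrite E; case: (c) (phi n a) (phi n b) => ? ? [? ?] [? ?].
  by apply: cvgD b2; apply: cvgD; apply: cvgM => //; exact: cvg_cst.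
- move=> a; have [h1 h2] := psiP (star a * a).
  have pos n : 0 <= phi n (star a * a) by have [_ h _] := st n.
  rewrite lecE; apply/andP; split => /=.
    apply/eqP; apply: (cvg_unique _ h2) => //; apply: cvg_near_cst; apply: filterE => n.
    exact: ger0_Im.
  apply: (closed_cvg _ (@closed_ge R 0) _ _ h1); apply: filterE => n /=.
  by have := pos n; rewrite lecE => /andP[].
- by apply: ev; exists 0%N => n _; have [_ _] := st n.
Qed.

End UltraLimit.


(** * The gauge action *)

Section Powers.
Context {R : realType}.
Implicit Types A B : cstarAlgType R.

Lemma upow_hom A B (h : {lrmorphism A -> B}) (u : A) (m : int) :
  star_preserving h -> h (upow u m) = upow (h u) m.
Proof. by move=> hs; case: m => n; rewrite /= rmorphXn /= ?hs. Qed.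

Lemma upowZ A (z : R[i]) (u : A) (m : int) : circle R z ->
  upow (z *: u) m = z ^ m *: upow u m.
Proof.
move=> Cz; case: m => n /=; first by rewrite exprZn.
by rewrite starZ circle_conj// exprZn exprVn.
Qed.

Lemma unitaryZ A (z : R[i]) (u : A) : circle R z -> unitary u -> unitary (z *: u).
Proof.
move=> Cz [su us]; have z0 := circle_neq0 Cz.
by split; rewrite starZ circle_conj// -scalerAl -scalerAr scalerA ?mulVf ?divff//
  ?su ?us scale1r.
Qed.

Lemma comp_positive A B (h : {lrmorphism A -> B}) (phi : B -> R[i]) :
  star_preserving h -> positive phi -> positive (phi \o h).
Proof.
move=> hs [lp pp]; split=> [c a b|a] /=; first by rewrite linearP lp.
by rewrite rmorphM /= hs.
Qed.

Lemma comp_state A B (h : {lrmorphism A -> B}) (phi : B -> R[i]) :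
  star_preserving h -> is_state phi -> is_state (phi \o h).
Proof.
move=> hs sp; have [lp pp] := comp_positive hs (state_positive sp).
by split=> //=; rewrite rmorph1; have [_ _] := sp.
Qed.

Lemma weighted_state A (M : nat) (w : 'I_M -> R[i]) (phi : 'I_M -> A -> R[i]) :
  (forall j, 0 <= w j) -> \sum_j w j = 1 -> (forall j, is_state (phi j)) ->
  is_state (fun a => \sum_j w j * phi j a).
Proof.
move=> w0 w1 sp; split.
- move=> c a b; rewrite mulr_sumr -big_split /=; apply: eq_bigr => j _.
  by have [-> _ _] := sp j; rewrite mulrDr mulrCA.
- by move=> a; apply: sumr_ge0 => j _; have [_ h _] := sp j; exact: mulr_ge0.
- by rewrite -[RHS]w1; apply: eq_bigr => j _; have [_ _ ->] := sp j; rewrite mulr1.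
Qed.

End Powers.

Section Gauge.
Context {R : realType} {A : cstarAlgType R}.
Variables (alpha : R) (U V : A).
Hypothesis torus : is_nctorus alpha U V.

(** The pair (U, z V) satisfies the same relations, so universality applies. *)
Lemma gauge_hom (z : R[i]) : circle R z -> exists h : {lrmorphism A -> A},
  [/\ star_preserving h, h U = U & h V = z *: V].
Proof.
move=> Cz; apply: nctorus_univ torus _ _ _ _.
have [uU uV UV] := nctorus_rel torus; split=> //; first exact: unitaryZ.
by rewrite -scalerAr -(scalerAl z) UV scalerA scalerA mulrC.
Qed.

Lemma gauge_monomial (h : {lrmorphism A -> A}) (z : R[i]) (m n : int) :
  circle R z -> star_preserving h -> h U = U -> h V = z *: V ->
  h (upow U m * upow V n) = z ^ n *: (upow U m * upow V n).
Proof.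
by move=> Cz hs hU hV; rewrite rmorphM /= !upow_hom// hU hV upowZ// scalerAr.
Qed.

Section Modulation.
Variables (Phi : {lrmorphism A -> A}) (phi : A -> R[i]).
Hypothesis Phi_star : star_preserving Phi.
Hypothesis phi_inv : invariant_states Phi phi.
Hypothesis Phi_gauge : forall (h : {lrmorphism A -> A}) (z : R[i]),
  circle R z -> star_preserving h -> h U = U -> h V = z *: V ->
  h (Phi U) = Phi (h U) /\ h (Phi V) = Phi (h V).

(** h and [Phi] commute on U and V, hence on monomials; [state_ext] extends this to all of [A] after
    composition with [phi]. *)
Lemma gauge_invariant (h : {lrmorphism A -> A}) (z : R[i]) (a : A) :
  circle R z -> star_preserving h -> h U = U -> h V = z *: V ->
  phi (h (Phi a)) = phi (h a).
Proof.
move=> Cz hs hU hV; have [sp ip] := phi_inv; have [eU eV] := Phi_gauge Cz hs hU hV.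
have pp := state_positive sp.
have : (phi \o h) \o Phi = (phi \o Phi) \o h.
  apply: (state_ext torus).
  - by apply: comp_positive => //; exact: comp_positive.
  - by apply: comp_positive => //; exact: comp_positive.
  move=> m n /=; congr phi.
  by rewrite !rmorphM /= !upow_hom// eU eV.
by move/(congr1 (@^~ a)) => /= ->; exact: (congr1 (@^~ (h a)) ip).
Qed.

(* The average of the states phi \o h_z over the gauge circle against the
   density 1 + s cos(k t), obtained as an ultralimit of averages over roots of
   unity. *)
Lemma modulated_state (k : int) (s : R[i]) : k != 0 -> Num.conj s = s -> s ^+ 2 = 1 ->
  exists2 psi, invariant_states Phi psi & forall m n : int,
    psi (upow U m * upow V n) =
      ((n == 0)%:R + s / 2 * ((n == - k)%:R + (n == k)%:R)) *
        phi (upow U m * upow V n).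
Proof.
move=> k0 sR s2; have [sp ip] := phi_inv; have pp := state_positive sp.
(* Large enough that n, n + k and n - k are all below M in absolute value once |n| <= N. *)
pose M N := (N + `|k|).+1.
pose w N : R[i] := cis (2 * pi / (M N)%:R).
have wp N : (M N).-primitive_root (w N) by exact: unit_root_prim.
have Cw N : circle R (w N) by exact: circle_cis.
have w0 N : w N != 0 by exact: circle_neq0.
have Cwj N j : circle R (w N ^+ j) by exact: circleX.
have hex Nj := gauge_hom (Cwj Nj.1 Nj.2).
have [h hP] := choice hex.
(* The density 1 + s cos(k t) sampled at t = 2 pi j / M, the cosine being half the sum of two
   conjugate roots of unity. *)
pose c N (j : 'I_(M N)) : R[i] :=
  (1 + s / 2 * ((w N ^ k) ^+ j + (w N ^ (- k)) ^+ j)) / (M N)%:R.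
have M0 N : ((M N)%:R : R[i]) != 0 by rewrite pnatr_eq0.
have c0 N j : 0 <= c N j.
  rewrite /c; set x := (w N ^ k) ^+ j.
  have Cx : circle R x.
    rewrite /x; apply: circleX; case: (k) => i; first exact: circleX.
    by rewrite /circle /= NegzE -invr_expz normfV (circleX _ (Cw N)) invr1.
  have x0 := circle_neq0 Cx.
  have -> : (w N ^ (- k)) ^+ j = x^-1 by rewrite -invr_expz exprVn.
  (* As s is real with s^2 = 1 and |x| = 1, the right-hand side is |1 + s x|^2 / 2. *)
  have -> : 1 + s / 2 * (x + x^-1) = ((1 + s * x) * (1 + s * x^-1)) / 2.
    have -> : (1 + s * x) * (1 + s * x^-1) = 1 + s ^+ 2 + s * (x + x^-1) by field.
    by rewrite s2; field.
  rewrite -(circle_conj Cx) -{2}sR -rmorphM -conjC_add1.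
  do 2! (apply: mulr_ge0; last by rewrite invr_ge0 ler0n).
  exact: mul_conjC_ge0.
(* The discrete Fourier coefficients of the weights: the exponents n, n + k and n - k each
   contribute only when they vanish. *)
have csum N (n : int) : (`|n| + `|k| < M N)%N ->
    \sum_j c N j * (w N ^+ j) ^ n =
    (n == 0)%:R + s / 2 * ((n == - k)%:R + (n == k)%:R).
  move=> nM.
  have E (j : 'I_(M N)) : c N j * (w N ^+ j) ^ n = (M N)%:R^-1 *
      ((w N ^ n) ^+ j + s / 2 * ((w N ^ (n + k)) ^+ j + (w N ^ (n - k)) ^+ j)).
    have -> : (w N ^+ j) ^ n = (w N ^ n) ^+ j by rewrite !exprnP !exprz_exp mulrC.
    by rewrite /c !expfzDr// !exprMn; ring.
  rewrite (eq_bigr _ (fun j _ => E j)) -mulr_sumr big_split /= -mulr_sumr big_split /=.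
  rewrite !(prim_root_geom (wp N)); [|lia..].
  rewrite subr_eq0 addr_eq0.
  have q (b : bool) : (if b then (M N)%:R else 0) = (M N)%:R * b%:R :> R[i].
    by case: b; rewrite ?mulr1 ?mulr0.
  by rewrite !q -mulrDr mulrCA -mulrDr mulKf.
pose ph N a : R[i] := \sum_j c N j * phi (h (N, nat_of_ord j) a).
have st N : is_state (ph N).
  apply: weighted_state => //.
    have := csum N 0; rewrite eqxx absz0 add0n => /(_ (leq_addl _ _)).
    rewrite eq_sym oppr_eq0 (negbTE k0) eq_sym (negbTE k0) addr0 mulr0 addr0 => c1.
    by apply: etrans c1; apply: eq_bigr => j _; rewrite expr0z mulr1.
  by move=> j; have [hs _ _] := hP (N, nat_of_ord j); exact: (comp_state hs sp).
have [psi spsi limpsi] := ultralimit_state st.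
exists psi.
  (* Each average is already exactly invariant, so its value at Phi a - a is constantly 0 and passes
     to the limit. *)
  split=> //; apply/funext => a /=; apply/eqP; rewrite -subr_eq0; apply/eqP.
  have [lpsi _ _] := spsi; rewrite -(scalarB lpsi); apply: limpsi.
  exists 0%N => N _; have [lph _ _] := st N; rewrite (scalarB lph).
  apply/eqP; rewrite subr_eq0; apply/eqP; apply: eq_bigr => j _; congr (_ * _).
  by have [hs hU hV] := hP (N, nat_of_ord j); exact: (gauge_invariant _ (Cwj N j)).
move=> m n; apply: limpsi; exists `|n|%N => N nN.
rewrite -(csum N n); last by rewrite ltnS leq_add2r.
rewrite mulr_suml; apply: eq_bigr => j _; rewrite -mulrA; congr (_ * _).
have [hs hU hV] := hP (N, nat_of_ord j).
by rewrite (gauge_monomial _ _ (Cwj N j)) // (scalarZ pp.1).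
Qed.

End Modulation.

End Gauge.

(** * Irrational rotation and uniqueness of the invariant state *)

Lemma cis_irrational (R : realType) (theta : R) (m : int) :
  irrational (theta / (2 * pi)) -> m != 0 -> cis theta ^ m != 1.
Proof.
move=> irr m0; apply/eqP => h.
have {}h : cis theta ^+ `|m| = 1.
  case: m m0 h => n _; first exact.
  by rewrite NegzE -invr_expz => /eqP; rewrite invr_eq1 => /eqP.
move: h; rewrite cisMn => /cis_eq1[k kE]; apply: irr; apply/rationalP.
have p0 : 2 * pi != 0 :> R by rewrite gt_eqF// mulr_gt0// pi_gt0.
have n0 : (`|m|%:R : R) != 0 by rewrite pnatr_eq0 absz_eq0.
exists k, `|m|%N; apply: (mulIf p0); apply: (mulIf n0).
by rewrite divfK// mulrAC divfK// mulr_natr kE.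
Qed.

Theorem theorem4p5 (R : realType) (theta alpha : R)
    (A : cstarAlgType R) (U V : A) (tau : A -> R[i])
    (f : R[i] -> R[i]) (Phi : {lrmorphism A -> A}) :
  irrational (theta / (2 * pi)) ->
  is_nctorus alpha U V ->
  is_canonical_trace U V tau ->
  set_fun (circle R) (circle R) f ->
  circle_continuous f ->
  is_anzai U V theta f Phi ->
  is_ergodic Phi tau ->
  uniquely_ergodic Phi /\ invariant_states Phi = [set tau].
Proof.
move=> irr torus trace fC cf anzai [tau_inv tau_ext].
suff unique phi : invariant_states Phi phi -> phi = tau.
  split.
    by exists tau; split=> // phi /unique.
  by apply/seteqP; split=> [phi /unique|phi ->].
move=> phi_inv; have [sp ip] := phi_inv; have pp := state_positive sp.
have st := trace_state trace; have pt := state_positive st.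
have Ps := anzai_star anzai.
have f1 z : circle R z -> `|f z| <= 1 by move=> /fC ->.
(* Commutation at V reduces to h (f(U)) = f(U), obtained from [calculus_fixed] with the faithful
   state [tau]. *)
have gauge (h : {lrmorphism A -> A}) (z : R[i]) :
    circle R z -> star_preserving h -> h U = U -> h V = z *: V ->
    h (Phi U) = Phi (h U) /\ h (Phi V) = Phi (h V).
  move=> Cz hs hU hV; split; first by rewrite hU (anzai_U anzai) linearZ /= hU.
  have [_ [rho cr <-] VE] := anzai_V anzai.
  rewrite VE hV linearZ /= VE rmorphM /= hV -scalerAr.
  by rewrite (calculus_fixed cr pt (trace_faithful trace) cf f1 hs hU).
have phiU (m : int) : m != 0 -> phi (upow U m) = 0.
  move=> m0.
  (* [Phi] multiplies U^m by e^(i m theta), a factor different from 1 by irrationality. *)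
  have E : cis theta ^ m * phi (upow U m) = phi (upow U m).
    rewrite -(scalarZ pp.1) -upowZ; last exact: circle_cis.
    by rewrite -(anzai_U anzai) -upow_hom//; exact: (congr1 (@^~ (upow U m)) ip).
  apply/eqP; move/eqP: E.
  rewrite -subr_eq0 -{2}[phi _]mul1r -mulrBl mulf_eq0 subr_eq0.
  by rewrite (negbTE (cis_irrational irr m0)).
have phiV (m k : int) : k != 0 -> phi (upow U m * upow V k) = 0.
  move=> k0.
  have [|||psi1 psi1_inv psi1E] := modulated_state torus Ps phi_inv gauge (k := k) (s := 1).
  - by [].
  - exact: rmorph1.
  - exact: expr1n.
  have [|||psi2 psi2_inv psi2E] := modulated_state torus Ps phi_inv gauge (k := k) (s := -1).
  - by [].
  - by rewrite rmorphN1.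
  - by rewrite sqrrN expr1n.
  (* The terms in s = 1 and s = -1 cancel in the midpoint, leaving the factor (n == 0) in front of
     [phi]. *)
  have tauE : tau = fun a => (2^-1 : R)%:C * psi1 a + (1 - 2^-1 : R)%:C * psi2 a.
    have -> : (1 - 2^-1 : R) = 2^-1 by field.
    have [[l1 q1 _] _] := psi1_inv; have [[l2 q2 _] _] := psi2_inv.
    have half0 : (0 : R[i]) <= (2^-1 : R)%:C by rewrite ler0c invr_ge0 ler0n.
    apply: (state_ext torus) => //.
      split=> [c a b|a]; first by rewrite l1 l2; ring.
      by rewrite addr_ge0// mulr_ge0.
    move=> m' n; rewrite psi1E psi2E (trace_monomial trace).
    have halfE : (2^-1 : R)%:C = 2^-1 by rewrite fmorphV rmorph_nat.
    transitivity ((n == 0)%:R * phi (upow U m' * upow V n)); last first.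
      by rewrite halfE; field.
    case: (eqVneq n 0) => [->|_]; last by rewrite andbF mul0r.
    rewrite andbT mul1r /= mulr1; case: (eqVneq m' 0) => [->|/phiU ->//].
    by have [_ _ ->] := sp.
  have [|psi1_tau _] := tau_ext psi1 psi2 2^-1 psi1_inv psi2_inv _ tauE.
    by apply/andP; split; lra.
  (* At n = k the equation psi1 = tau reads 0 = phi (U^m V^k) / 2, since k differs from both 0 and
     -k. *)
  have := psi1E m k; rewrite psi1_tau (trace_monomial trace) (negbTE k0) andbF eqxx.
  have -> : (k == - k) = false by apply/negbTE; rewrite -addr_eq0; lia.
  rewrite !add0r mulr1 mul1r => /esym/eqP.
  by rewrite mulf_eq0 invr_eq0 pnatr_eq0 => /eqP.
apply: (state_ext torus) => // m n; rewrite (trace_monomial trace).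
case: (eqVneq n 0) => [->|n0]; last by rewrite andbF phiV.
rewrite andbT /= mulr1; case: (eqVneq m 0) => [->|/phiU ->//].
by have [_ _ ->] := sp.
Qed.
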